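(* Let $E$ be a row-finite directed graph with no sources and let $R$ be an integral domain with identity. Let $\sim$ be the equivalence relation on $\{(n, x) : n \in N(E), x \in \operatorname{Dom}(n)\}$ defined in the context, and denote the collection of equivalence classes by $W_E$. Then $W_E$, equipped with the following structure, is a groupoid: - partially-defined product $[(n_1, x_1)][(n_2, x_2)] := [(n_1n_2, x_2)]$ if $\alpha_{n_2}(x_2) = x_1$; - unit space $W_E^{(0)}:=\{[(d,x)]:d\in D(E), x\in \operatorname{Dom}(d)\}$; - range and source maps $r,s:W_E\to W_E^{(0)}$ defined by $r([(n,x)]):=[(nn^*,\alpha_n(x))]$ and $s([(n,x)]):=[(n^*n,x)]$; - inverse $[(n,x)]^{-1}:=[(n^*,\alpha_n(x))]$.
   Context: A directed graph $E=(E^0,E^1,r,s)$ consists of countable sets $E^0$ (vertices), $E^1$ (edges) and maps $r,s:E^1\to E^0$. It is row-finite if $r^{-1}(v)$ is finite for every $v\in E^0$, and has no sources if $r^{-1}(v)\neq\emptyset$ for every $v$. Paths are sequences of edges $\mu=\mu_1\mu_2\cdots$ with $s(\mu_i)=r(\mu_{i+1})$; $P(E)$ is the set of finite paths (vertices are paths of length $0$, with $r(v)=s(v)=v$), $|\mu|$ is the length of $\mu\in P(E)$, $r(\mu)=r(\mu_1)$, $s(\mu)=s(\mu_{|\mu|})$, and $E^\infty$ is the set of infinite paths. Graph groupoid: $G_E$ is the set of triples $(x,k,y)\in E^\infty\times\mathbb{Z}\times E^\infty$ such that there are $\mu,\nu\in P(E)$ and $z\in E^\infty$ with $x=\mu z$,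 $y=\nu z$, $k=|\mu|-|\nu|$; $r(x,k,y)=x$, $s(x,k,y)=y$, $(x,k,y)(y,l,z)=(x,k+l,z)$, $(x,k,y)^{-1}=(y,-k,x)$, and $x\in E^\infty$ is identified with the unit $(x,0,x)$. For $\mu,\nu\in P(E)$ with $s(\mu)=s(\nu)$ put $Z(\mu,\nu)=\{(\mu z,|\mu|-|\nu|,\nu z): z\in E^\infty, r(z)=s(\mu)\}$; these sets form a basis for the (Hausdorff) topology of $G_E$, and are compact. $Z(\mu)=\{\mu z\}$ is identified with $Z(\mu,\mu)$, and $E^\infty$ has the topology with basis the $Z(\mu)$. For $B\subset G_E$ and $x\in E^\infty$, $Bx=\{\gamma\in B:s(\gamma)=x\}$. The integral domain $R$ has an involution $r\mapsto\overline r$ (a ring automorphism with $\overline{\overline r}=r$). The Leavitt path algebra $L_R(E)$ is viewed as the Steinberg algebra of $G_E$: the $R$-span of the characteristic functions $\mathbf 1_{Z(\mu,\nu)}:G_E\to R$, with convolution product $f*g(\gamma)=\sum_{r(\eta)=r(\gamma)}f(\eta)g(\eta^{-1}\gamma)$ (also written $fg$) and involution $f^*(\gamma)=\overline{f(\gamma^{-1})}$. It is $\mathbb{Z}$-graded: $f$ is homogeneous of degree $k$ if $\operatorname{supp}(f)=\{\gamma:f(\gamma)\neq0\}\subset\{(x,k,y)\in G_E\}$. The diagonal is $D(E)=\operatorname{span}_R\{\mathbf 1_{Z(\mu)}:\mu\in P(E)\}$. An element $n\in L_R(E)$ is a normalizer of $D(E)$ if $ndn^*,\,n^*dn\in D(E)$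 for all $d\in D(E)$; $N(E)$ is the set of normalizers. It is closed under products and $*$, contains $D(E)$, and $nn^*,n^*n\in D(E)$ for $n\in N(E)$. For $n\in N(E)$: $\operatorname{Dom}(n)=\operatorname{supp}(n^*n)\subset E^\infty$. For $x\in s(\operatorname{supp}(n))$ the set $r(\operatorname{supp}(n)x)$ is a singleton, and $\alpha_n(x)$ denotes its unique element. If $x$ is an isolated point of $E^\infty$ (''isolated path''), $p_x:=\mathbf 1_{\{x\}}\in D(E)$; then $p_xnp_x$ is homogeneous for every $n\in N(E)$. The relation $\sim$: $(n,x)\sim(m,x')$ if $x=x'$ and either (i) $x$ is an isolated path, $\alpha_n(x)=\alpha_m(x)$ and the degree of $p_xn^*mp_x$ is $0$; or (ii) $x$ is not isolated and there is an open neighbourhood $V\subset\operatorname{Dom}(n)\cap\operatorname{Dom}(m)$ of $x$ with $\alpha_n(y)=\alpha_m(y)$ for all $y\in V$. $[(n,x)]$ is the class of $(n,x)$. *)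

(* Defs.v *)
From HB Require Import structures.
From mathcomp Require Import all_boot all_order all_algebra.
From mathcomp Require Import all_classical topology numfun.

Set Implicit Arguments.
Unset Strict Implicit.
Unset Printing Implicit Defensive.

Import Order.TTheory GRing.Theory Num.Theory.
Local Open Scope classical_set_scope.
Local Open Scope ring_scope.

Record digraph := Digraph {
  vertex : countType;
  edge : countType;
  erange : edge -> vertex;
  esource : edge -> vertex }.

Definition row_finite (E : digraph) : Prop :=
  forall v : vertex E, finite_set [set e : edge E | erange e = v].

Definition no_sources (E : digraph) : Prop :=
  forall v : vertex E, exists e : edge E, erange e = v.

Section Paths.
Variable E : digraph.

Fixpoint path_from (v : vertex E) (p : seq (edge E)) : bool :=
  if p is e :: p' then (erange e == v) && path_from (esource e) p' else true.

(* The range vertex is stored so that vertices are the paths of length 0. *)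
Record fpath := FPath {
  frange : vertex E;
  fedges : seq (edge E);
  fpathP : path_from frange fedges }.

Definition fsource (mu : fpath) : vertex E :=
  last (frange mu) [seq esource e | e <- fedges mu].

Definition flength (mu : fpath) : nat := size (fedges mu).

Record infpath := InfPath {
  infedge :> nat -> edge E;
  infpathP : forall i, esource (infedge i) = erange (infedge i.+1) }.

HB.instance Definition _ := gen_eqMixin infpath.
HB.instance Definition _ := gen_choiceMixin infpath.

Definition infrange (z : infpath) : vertex E := erange (z 0%N).

(* [is_cat mu z x] reads "mu z is defined and x = mu z". *)
Definition is_cat (mu : fpath) (z x : infpath) : Prop :=
  fsource mu = infrange z /\
  forall i, x i = if (i < flength mu)%N then nth (z 0%N) (fedges mu) i
                  else z (i - flength mu)%N.

Definition cylinder (mu : fpath) : set infpath :=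
  [set x | exists z, is_cat mu z x].

Lemma infpath_ext (x y : infpath) : (forall i, x i = y i) -> x = y.
Proof.
case: x y => [x px] [y py] /= /funext xy; move: px py.
by rewrite xy => px py; congr InfPath; exact: Prop_irrelevance.
Qed.

Section Prefix.
Variable x : infpath.

Lemma prefix_subproof n i :
  path_from (erange (x i)) [seq x j | j <- iota i n].
Proof. by elim: n i => //= n IH i; rewrite eqxx infpathP IH. Qed.

Definition inf_prefix (n : nat) : fpath := FPath (prefix_subproof n 0).

Lemma shift_subproof n i : esource (x (n + i)%N) = erange (x (n + i.+1)%N).
Proof. by rewrite addnS infpathP. Qed.

Definition inf_shift (n : nat) : infpath := InfPath (shift_subproof n).

Lemma flength_prefix n : flength (inf_prefix n) = n.
Proof. by rewrite /flength /= size_map size_iota. Qed.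

Lemma fsource_prefix n : fsource (inf_prefix n) = erange (x n).
Proof.
rewrite /fsource /= -[in RHS](add0n n).
elim: n 0%N => [|n IH] i /=; first by rewrite addn0.
by rewrite infpathP IH addSnnS.
Qed.

Lemma is_cat_prefix n : is_cat (inf_prefix n) (inf_shift n) x.
Proof.
split=> [|i]; first by rewrite fsource_prefix /infrange /= addn0.
rewrite flength_prefix; case: ltnP => /= [lin|lni]; last by rewrite subnKC.
by rewrite (nth_map 0%N) ?size_iota // nth_iota.
Qed.

End Prefix.

Lemma cylinder_edges (mu : fpath) (x : infpath) : cylinder mu x ->
  frange mu = infrange x /\
  forall i, (i < flength mu)%N -> x i = nth (x 0%N) (fedges mu) i.
Proof.
case: mu => v p vp [z [sz xz]]; split; last first.
  move=> i li; rewrite xz li; exact: set_nth_default.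
move: sz xz; rewrite /infrange /fsource /flength /=.
case: p vp => /= [|e p] vp sz xz; first by rewrite xz subn0.
by rewrite (xz 0%N) /=; case/andP: vp => /eqP.
Qed.

Lemma cylinder_prefix (mu : fpath) (x : infpath) : cylinder mu x ->
  fedges (inf_prefix x (flength mu)) = fedges mu.
Proof.
move=> /cylinder_edges[_ xmu]; apply: (@eq_from_nth _ (x 0%N)) => /=.
  by rewrite size_map size_iota.
move=> i; rewrite size_map size_iota => li.
by rewrite (nth_map 0%N) ?size_iota // nth_iota // xmu.
Qed.

Lemma cylinder_ge (mu : fpath) (x : infpath) n : cylinder mu x ->
  (flength mu <= n)%N -> cylinder (inf_prefix x n) `<=` cylinder mu.
Proof.
move=> xmu ln y yx; have [yr yn] := cylinder_edges yx.
have [xr xn] := cylinder_edges xmu.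
exists (inf_shift y (flength mu)).
have yE i : (i < flength mu)%N -> y i = x i.
  move=> li; rewrite yn ?flength_prefix ?(leq_trans li) //=.
  by rewrite (nth_map 0%N) ?size_iota ?nth_iota ?(leq_trans li).
have e : fedges (inf_prefix y (flength mu)) = fedges mu.
  rewrite -(cylinder_prefix xmu) /=; apply/eq_in_map => i.
  by rewrite mem_iota add0n => /andP[_ /yE].
have re : frange (inf_prefix y (flength mu)) = frange mu.
  by rewrite xr; exact: esym yr.
have [h1 h2] := is_cat_prefix y (flength mu).
move: h1 h2; rewrite /fsource re e flength_prefix => h1 h2.
by split.
Qed.

Lemma cylinder_cover : \bigcup_(A in range cylinder) A = setT.
Proof.
rewrite -subTset => x _; exists (cylinder (inf_prefix x 0)).
  by exists (inf_prefix x 0).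
by exists (inf_shift x 0); exact: is_cat_prefix.
Qed.

Lemma cylinder_join (A B : set infpath) (t : infpath) :
  range cylinder A -> range cylinder B -> A t -> B t ->
  exists C, [/\ range cylinder C, C t & C `<=` A `&` B].
Proof.
move=> [mu _ <-] [nu _ <-] tmu tnu.
pose n := maxn (flength mu) (flength nu).
exists (cylinder (inf_prefix t n)); split; first by exists (inf_prefix t n).
  by exists (inf_shift t n); exact: is_cat_prefix.
move=> y yt; split;
  by [apply: (cylinder_ge tmu) yt; rewrite leq_maxl
     |apply: (cylinder_ge tnu) yt; rewrite leq_maxr].
Qed.

HB.instance Definition _ :=
  @isBaseTopological.Build infpath (set infpath) (range cylinder) id
    cylinder_cover cylinder_join.

Definition isolated_path (x : infpath) : Prop := open [set x].

Definition triple : Type := (infpath * int * infpath)%type.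

Definition graph_groupoid_set : set triple :=
  [set t | exists mu nu z, [/\ is_cat mu z t.1.1, is_cat nu z t.2 &
     t.1.2 = (flength mu)%:Z - (flength nu)%:Z]].

Definition graph_groupoid : Type := set_type graph_groupoid_set.

Implicit Types g h : graph_groupoid.

Definition grange g : infpath := (val g).1.1.
Definition gdegree g : int := (val g).1.2.
Definition gsource g : infpath := (val g).2.

Lemma graph_groupoid_setP (x y : infpath) (k : int) :
  graph_groupoid_set (x, k, y) <->
  exists i j : nat, k = i%:Z - j%:Z /\ forall n, x (i + n)%N = y (j + n)%N.
Proof.
split=> [[mu [nu [z [/= [_ xz] [_ yz] ->]]]]|[i [j [-> xy]]]].
  exists (flength mu), (flength nu); split=> // n.
  by rewrite xz yz !ltnNge !leq_addr /= !addKn.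
exists (inf_prefix x i), (inf_prefix y j), (inf_shift x i).
split=> /=; rewrite ?flength_prefix //; first exact: is_cat_prefix.
suff -> : inf_shift x i = inf_shift y j by exact: is_cat_prefix.
exact: infpath_ext.
Qed.

Lemma graph_groupoid_unit (x : infpath) : graph_groupoid_set (x, 0, x).
Proof. by apply/graph_groupoid_setP; exists 0%N, 0%N. Qed.

Lemma graph_groupoid_inv (x y : infpath) (k : int) :
  graph_groupoid_set (x, k, y) -> graph_groupoid_set (y, - k, x).
Proof.
move=> /graph_groupoid_setP[i [j [-> xy]]]; apply/graph_groupoid_setP.
by exists j, i; rewrite opprB; split=> // n; rewrite xy.
Qed.

Lemma graph_groupoid_mul (x y z : infpath) (k l : int) :
  graph_groupoid_set (x, k, y) -> graph_groupoid_set (y, l, z) ->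
  graph_groupoid_set (x, k + l, z).
Proof.
move=> /graph_groupoid_setP[i [j [-> xy]]] /graph_groupoid_setP[a [b [-> yz]]].
apply/graph_groupoid_setP; exists (i + a)%N, (j + b)%N; split.
  by rewrite !PoszD opprD addrACA.
move=> n; rewrite -addnA xy.
by rewrite addnCA yz addnCA addnA.
Qed.

(* Membership [t \in A] of [set_type] is the boolean reflection of [A t]. *)
Definition gunit (x : infpath) : graph_groupoid :=
  exist _ (x, 0, x) (mem_set (graph_groupoid_unit x)).

Lemma ginv_subproof g :
  (gsource g, - gdegree g, grange g) \in graph_groupoid_set.
Proof.
case: g => -[[x k] y] xky; apply/mem_set/graph_groupoid_inv.
exact: set_mem xky.
Qed.

Definition ginv g : graph_groupoid :=
  exist _ (gsource g, - gdegree g, grange g) (ginv_subproof g).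

(* The value when [gsource g <> grange h] is irrelevant; see [gmulE]. *)
Definition gmul g h : graph_groupoid :=
  insubd g (grange g, gdegree g + gdegree h, gsource h).

Lemma gmulE g h : gsource g = grange h ->
  val (gmul g h) = (grange g, gdegree g + gdegree h, gsource h).
Proof.
case: g h => -[[x k] y] xky [[[y' l] z] yz]; rewrite /gsource/grange/= => yy'.
subst y'; rewrite /gmul insubdK //; apply/mem_set.
exact: (graph_groupoid_mul (set_mem xky) (set_mem yz)).
Qed.

Definition bisection (mu nu : fpath) : set graph_groupoid :=
  [set g | exists z, [/\ is_cat mu z (grange g), is_cat nu z (gsource g) &
     gdegree g = (flength mu)%:Z - (flength nu)%:Z]].

End Paths.

Definition indic_span (R : pzRingType) (T : Type) (C : set (set T)) :
    set (T -> R) :=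
  [set f | exists n (c : 'I_n -> R) (B : 'I_n -> set T),
     (forall i, C (B i)) /\ f = (fun t => \sum_(i < n) c i * \1_(B i) t)].

Arguments indic_span R {T} C.

Section Leavitt.
Variables (E : digraph) (R : idomainType) (bar : R -> R).

Local Notation G := (graph_groupoid E).
Implicit Types (f g n m d : G -> R) (x y : infpath E).

Definition leavitt : set (G -> R) :=
  indic_span R [set B | exists mu nu,
    fsource mu = fsource nu /\ B = bisection mu nu].

Definition lpa_diagonal : set (G -> R) :=
  indic_span R [set B | exists mu, B = bisection mu mu].

Definition sconv f g : G -> R := fun c =>
  \sum_(h \in [set h | grange h = grange c]) f h * g (gmul (ginv h) c).

Definition sstar f : G -> R := fun c => bar (f (ginv c)).

Definition supp f : set G := [set c | f c != 0].

Definition homogeneous (k : int) f : Prop :=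
  supp f `<=` [set c | gdegree c = k].

Definition lpa_normalizer : set (G -> R) :=
  [set n | leavitt n /\ forall d, lpa_diagonal d ->
     lpa_diagonal (sconv (sconv n d) (sstar n)) /\
     lpa_diagonal (sconv (sconv (sstar n) d) n)].

Definition Dom n : set (infpath E) :=
  [set x | supp (sconv (sstar n) n) (gunit x)].

(* [alpha n x] is an element of r(supp(n)x), which is a singleton when [n] is
   a normalizer and [x] is in s(supp(n)); otherwise the value is irrelevant. *)
Definition alpha n x : infpath E :=
  xget x (@grange E @` [set c | supp n c /\ gsource c = x]).

Definition p_ x : G -> R := \1_[set gunit x].

Definition germ_cond n m x : Prop :=
  (isolated_path x /\ alpha n x = alpha m x /\
   homogeneous 0 (sconv (sconv (sconv (p_ x) (sstar n)) m) (p_ x))) \/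
  (~ isolated_path x /\
   exists V : set (infpath E), [/\ open V, V x, V `<=` Dom n `&` Dom m &
     forall y, V y -> alpha n y = alpha m y]).

Definition admissible n x : Prop := lpa_normalizer n /\ Dom n x.

Definition germ_pair : Type :=
  {p : (G -> R) * infpath E | admissible p.1 p.2}.

Definition germ_rel (p q : germ_pair) : Prop :=
  (sval p).2 = (sval q).2 /\
  germ_cond (sval p).1 (sval q).1 (sval p).2.

(* The set W_E, as a set of equivalence classes. *)
Definition germ_class : Type :=
  {C : set germ_pair | exists p, C = [set q | germ_rel p q]}.

Definition germ n x (nx : admissible n x) : germ_class :=
  let p : germ_pair := exist _ (n, x) nx in
  exist _ [set q | germ_rel p q] (ex_intro _ p erefl).

Definition germ_units : set germ_class :=
  [set u | exists d x (dx : admissible d x), lpa_diagonal d /\ u = germ dx].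

End Leavitt.

(* A groupoid on [W] with unit space [U]; [mul a b = None] means that the
   product of [a] and [b] is not defined. *)
Record is_groupoid (W : Type) (U : set W) (r s : W -> W)
    (mul : W -> W -> option W) (inv : W -> W) : Prop := IsGroupoid {
  range_unit : forall a, U (r a);
  source_unit : forall a, U (s a);
  unit_range : forall u, U u -> r u = u;
  unit_source : forall u, U u -> s u = u;
  mul_defined : forall a b, mul a b <> None <-> s a = r b;
  mul_range : forall a b c, mul a b = Some c -> r c = r a;
  mul_source : forall a b c, mul a b = Some c -> s c = s b;
  mul_assoc : forall a b c ab bc, mul a b = Some ab -> mul b c = Some bc ->
    mul ab c = mul a bc;
  mul_unit_l : forall a, mul (r a) a = Some a;
  mul_unit_r : forall a, mul a (s a) = Some a;
  mul_inv_r : forall a, mul a (inv a) = Some (r a);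
  mul_inv_l : forall a, mul (inv a) a = Some (s a) }.

(* Main.v *)
Require Import Defs.
From mathcomp Require Import all_boot all_order all_algebra.
From mathcomp Require Import all_classical topology numfun.
From mathcomp Require Import zify.
From Stdlib Require Import RelationClasses.

Set Implicit Arguments.
Unset Strict Implicit.
Unset Printing Implicit Defensive.

Import Order.TTheory GRing.Theory Num.Theory.
Local Open Scope classical_set_scope.
Local Open Scope ring_scope.

(** The groupoid [W_E] is a copy of the graph groupoid [G_E].

    Call [n] bisective when range and source are injective on its support. The
    normalizers of [D(E)] are exactly the bisective elements of [L_R(E)]
    ([normalizerP]). For the harder direction, let [c1] and [c2] lie in [supp n]
    with the same source [x], [c1] of largest degree among the elements of [supp n]
    with its range and source, [c2] of smallest degree. If [mu] is a long prefix of
    [x], then [n 1_Z(mu) n^*] takes the value [n(c1) bar(n(c2))] at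
    [c1 c2^-1]: other contributions would come from an element of larger degree
    than [c1] or an element of smaller degree than [c2]. As [R] is a domain the
    value is nonzero, and as the function lies in [D(E)] the point [c1 c2^-1] is a
    unit ([normalizer_extremal]). This forces all the elements of [supp n] with
    source [x] to have the same range and the same degree. This is the argument
    by which a product of nonzero Laurent polynomials over a domain is nonzero.
    Conversely, [n d n^*] is supported on units when [n] is bisective, and an
    element of [L_R(E)] supported on units is in [D(E)] ([leavitt_diagonal]).

    Thus a normalizer [n] and a point [x] of [Dom(n)] determine one element of
    [G_E], the element of [supp n] with source [x] ([branch]). Two pairs are
    equivalent if and only if they determine the same element ([germ_condP]):
    elements of [L_R(E)] are locally constant, so normalizers with a common
    element at [x] have the same [alpha] near [x]; conversely, if the [alpha] agree
    near [x] but the degrees at [x] differ, the difference of the degrees is a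
    period of every path near [x], so that [x] is isolated ([lag_isolated]), where
    the relation compares degrees explicitly. Every element of [G_E] arises, from
    the indicator of a basic bisection. So the classes are in bijection with
    [G_E]; convolution and involution of normalizers correspond to product and
    inverse in [G_E] ([branch_sconv], [branch_sstar]), and the groupoid axioms are
    those of [G_E]. *)

(** * Spans of indicator functions *)

Section Span.
Variables (R : idomainType) (T : Type) (C : set (set T)).
Implicit Types f g : T -> R.

Lemma indic_span0 : indic_span R C (fun=> 0).
Proof.
exists 0%N, (fun=> 0), (fun=> set0); split=> [[] //|].
by apply/funext => t; rewrite big_ord0.
Qed.

Lemma indic_span_cons a B f : C B -> indic_span R C f ->
  indic_span R C (fun t => a * \1_B t + f t).
Proof.
move=> CB [n [c [D [CD ->]]]].
exists n.+1, (fun i => oapp c a (unlift ord0 i)),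
  (fun i => oapp D B (unlift ord0 i)); split.
  by move=> i; case: (unliftP ord0 i) => [j|] _ /=.
apply/funext => t; rewrite big_ord_recl unlift_none /=; congr (_ + _).
by apply: eq_bigr => i _; rewrite liftK.
Qed.

Lemma indic_span_ind (P : (T -> R) -> Prop) :
  P (fun=> 0) ->
  (forall a B f, C B -> indic_span R C f -> P f ->
    P (fun t => a * \1_B t + f t)) ->
  forall f, indic_span R C f -> P f.
Proof.
move=> P0 PS f [n [c [D [CD ->]]]]; elim: n c D CD => [|n IH] c D CD.
  rewrite (_ : (fun _ => _) = (fun=> 0)) //.
  by apply/funext => t; rewrite big_ord0.
rewrite (_ : (fun _ => _) = (fun t => c ord0 * \1_(D ord0) t +
  \sum_(i < n) c (lift ord0 i) * \1_(D (lift ord0 i)) t)); last first.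
  by apply/funext => t; rewrite big_ord_recl.
apply: PS => //; last exact: IH.
by exists n, (fun i => c (lift ord0 i)), (fun i => D (lift ord0 i)).
Qed.

Lemma indic_span_indic B : C B -> indic_span R C \1_B.
Proof.
move=> CB; have := indic_span_cons 1 CB indic_span0.
by congr indic_span; apply/funext => t; rewrite mul1r addr0.
Qed.

Lemma indic_spanD f g : indic_span R C f -> indic_span R C g ->
  indic_span R C (fun t => f t + g t).
Proof.
move=> Cf Cg; elim/indic_span_ind: f / Cf => [|a B f CB _ IH].
  by rewrite (_ : (fun _ => _) = g) //; apply/funext => t; rewrite add0r.
rewrite (_ : (fun _ => _) = (fun t => a * \1_B t + (f t + g t))).
  exact: indic_span_cons.
by apply/funext => t; rewrite addrA.
Qed.

Lemma indic_spanZ a f : indic_span R C f -> indic_span R C (fun t => a * f t).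
Proof.
move=> Cf; elim/indic_span_ind: f / Cf => [|b B f CB _ IH].
  rewrite (_ : (fun _ => _) = fun=> 0); first exact: indic_span0.
  by apply/funext => t; rewrite mulr0.
rewrite (_ : (fun _ => _) = (fun t => (a * b) * \1_B t + a * f t)).
  exact: indic_span_cons.
by apply/funext => t; rewrite mulrDr mulrA.
Qed.

End Span.

Lemma indic_neq0 (R : idomainType) (T : Type) (B : set T) t :
  (\1_B t : R) != 0 <-> B t.
Proof.
rewrite indicE; split=> [|Bt]; last by rewrite mem_set // oner_eq0.
by case: (boolP (t \in B)) => [/set_mem //|_]; rewrite eqxx.
Qed.

Lemma indic_eq0 (R : idomainType) (T : Type) (B : set T) t :
  ~ B t -> (\1_B t : R) = 0.
Proof. by move=> nB; apply/eqP/negP => /negP/indic_neq0. Qed.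

Lemma indic_eq1 (R : idomainType) (T : Type) (B : set T) t :
  B t -> (\1_B t : R) = 1.
Proof. by move=> Bt; rewrite indicE mem_set. Qed.

(** * The path space *)

Section PathSpace.
Variable E : digraph.
Implicit Types (x y z w : infpath E) (mu nu : Defs.fpath E) (N : nat).

Definition agree N x y := forall i, (i < N)%N -> x i = y i.

Lemma fpath_eq mu nu : frange mu = frange nu -> fedges mu = fedges nu ->
  mu = nu.
Proof.
case: mu nu => [v p pv] [w q qw] /= vw pq; subst w q; congr FPath.
exact: bool_irrelevance.
Qed.

Lemma is_catE mu z x :
  is_cat mu z x <-> cylinder mu x /\ z = inf_shift x (flength mu).
Proof.
split=> [zx|[[w wx] ->]]; last first.
  suff <- : w = inf_shift x (flength mu) by [].
  by apply: infpath_ext => i /=; case: wx => _ ->; rewrite ltnNge leq_addr addKn.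
split; first by exists z.
by apply: infpath_ext => i /=; case: zx => _ ->; rewrite ltnNge leq_addr addKn.
Qed.

Lemma cylinder_prefix_self x N : cylinder (inf_prefix x N) x.
Proof. by exists (inf_shift x N); exact: is_cat_prefix. Qed.

(** The condition on the first vertices matters only for [mu] of length 0, which
    constrains no edge. *)
Lemma cylinder_transfer mu x y : cylinder mu x -> infrange x = infrange y ->
  agree (flength mu) x y -> cylinder mu y.
Proof.
move=> xmu rxy xy; apply: (cylinder_ge xmu (leqnn _)).
move: (flength mu) xy => n xy.
exists (inf_shift y n); split.
  rewrite fsource_prefix /infrange /= addn0.
  by case: n xy => [//|n] xy; rewrite -!infpathP xy.
move=> i; rewrite flength_prefix /=; case: ltnP => ni; last by rewrite subnKC.
by rewrite (nth_map 0%N) ?size_iota // nth_iota // add0n xy.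
Qed.

Lemma cylinder_agree mu x N y : (0 < N)%N -> (flength mu <= N)%N ->
  cylinder mu x -> agree N x y -> cylinder mu y.
Proof.
move=> N0 muN xmu xy; apply: (cylinder_transfer xmu).
  by rewrite /infrange xy.
by move=> i imu; apply: xy; exact: leq_trans imu muN.
Qed.

Lemma cylinder_prefixP x N y : cylinder (inf_prefix x N) y -> agree N x y.
Proof.
move=> /cylinder_edges[_]; rewrite flength_prefix => yx i iN; rewrite yx //=.
by rewrite (nth_map 0%N) ?size_iota // nth_iota.
Qed.

Lemma cylinder_eq_prefix mu x :
  cylinder mu x -> mu = inf_prefix x (flength mu).
Proof.
move=> xmu; apply: fpath_eq; last by rewrite (cylinder_prefix xmu).
by rewrite (cylinder_edges xmu).1.
Qed.

Lemma cylinder2_agree mu x y :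
  cylinder mu x -> cylinder mu y -> agree (flength mu) x y.
Proof. by move=> xmu; rewrite {1}(cylinder_eq_prefix xmu) => /cylinder_prefixP. Qed.

Lemma open_cylinder mu : open (cylinder mu).
Proof.
exists [set cylinder mu]; first by move=> _ ->; exists mu.
by rewrite bigcup_set1.
Qed.

Lemma open_agree (V : set (infpath E)) x : open V -> V x ->
  exists N, forall y, agree N x y -> V y.
Proof.
move=> [D DC <-] [B DB xB]; have [mu _ muB] := DC _ DB.
exists (flength mu).+1 => y xy; exists B => //; rewrite /= -muB in xB *.
exact: (cylinder_agree _ _ xB xy).
Qed.

Lemma agree_isolated x N : (forall y, agree N x y -> y = x) -> isolated_path x.
Proof.
move=> xN; rewrite /isolated_path.
suff -> : [set x] = cylinder (inf_prefix x N) by exact: open_cylinder.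
apply/seteqP; split=> [_ ->|y /cylinder_prefixP/xN] //.
exact: cylinder_prefix_self.
Qed.

End PathSpace.

(** * The graph groupoid and its basic bisections *)

Section Groupoid.
Variable E : digraph.
Local Notation G := (graph_groupoid E).
Implicit Types (g h c : G) (x y w : infpath E) (mu nu : Defs.fpath E).

Lemma ggP g h : grange g = grange h -> gdegree g = gdegree h ->
  gsource g = gsource h -> g = h.
Proof.
rewrite /grange /gdegree /gsource => e1 e2 e3; apply: val_inj.
by case: (val g) (val h) e1 e2 e3 => [[? ?] ?] [[? ?] ?] /= -> -> ->.
Qed.

Lemma grangeM g h : gsource g = grange h -> grange (gmul g h) = grange g.
Proof. by move=> /gmulE e; rewrite {1}/grange [val _]e. Qed.

Lemma gsourceM g h : gsource g = grange h -> gsource (gmul g h) = gsource h.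
Proof. by move=> /gmulE e; rewrite {1}/gsource [val _]e. Qed.

Lemma gdegreeM g h : gsource g = grange h ->
  gdegree (gmul g h) = gdegree g + gdegree h.
Proof. by move=> /gmulE e; rewrite {1}/gdegree [val _]e. Qed.

Lemma grangeV g : grange (ginv g) = gsource g. Proof. by []. Qed.
Lemma gsourceV g : gsource (ginv g) = grange g. Proof. by []. Qed.
Lemma gdegreeV g : gdegree (ginv g) = - gdegree g. Proof. by []. Qed.
Lemma grange1 x : grange (gunit x) = x. Proof. by []. Qed.
Lemma gsource1 x : gsource (gunit x) = x. Proof. by []. Qed.
Lemma gdegree1 x : gdegree (gunit x) = 0. Proof. by []. Qed.

Lemma ginvK : involutive (@ginv E).
Proof. by move=> g; apply: ggP; rewrite // !gdegreeV opprK. Qed.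

Lemma gmulA g h c : gsource g = grange h -> gsource h = grange c ->
  gmul (gmul g h) c = gmul g (gmul h c).
Proof.
move=> gh hc; have e1 : gsource (gmul g h) = grange c by rewrite gsourceM.
have e2 : gsource g = grange (gmul h c) by rewrite grangeM.
by apply: ggP; rewrite ?(grangeM, gsourceM, gdegreeM) // addrA.
Qed.

Lemma gmulVg g : gmul (ginv g) g = gunit (gsource g).
Proof.
by apply: ggP; rewrite ?(grangeM, gsourceM, gdegreeM) // gdegreeV addNr.
Qed.

Lemma gmulgV g : gmul g (ginv g) = gunit (grange g).
Proof.
by apply: ggP; rewrite ?(grangeM, gsourceM, gdegreeM) // gdegreeV subrr.
Qed.

Lemma gmul1g g : gmul (gunit (grange g)) g = g.
Proof. by apply: ggP; rewrite ?(grangeM, gsourceM, gdegreeM) // add0r. Qed.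

Lemma gmulg1 g : gmul g (gunit (gsource g)) = g.
Proof. by apply: ggP; rewrite ?(grangeM, gsourceM, gdegreeM) // addr0. Qed.

Lemma gmulKg h c : gsource h = grange c -> gmul (ginv h) (gmul h c) = c.
Proof.
by move=> hc; rewrite -gmulA // gmulVg hc gmul1g.
Qed.

Lemma gmulVKg h c : grange h = grange c -> gmul h (gmul (ginv h) c) = c.
Proof. by move=> hc; have := @gmulKg (ginv h) c hc; rewrite ginvK. Qed.

(** Every element of [G] removes a prefix of length [a] from its range and a prefix
    of length [b] from its source; the pair [(a, b)] may be enlarged to
    [(a + i, b + i)], and only its difference is determined. *)
Definition tail a b g :=
  gdegree g = a%:Z - b%:Z /\ forall i, grange g (a + i)%N = gsource g (b + i)%N.

Lemma tail_ex g : exists a b, tail a b g.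
Proof.
case: g => -[[x k] y] gP.
have /graph_groupoid_setP[a [b [kab ab]]] := set_mem gP.
by exists a, b.
Qed.

Lemma bisectionP mu nu g : bisection mu nu g <->
  [/\ cylinder mu (grange g), cylinder nu (gsource g) &
      tail (flength mu) (flength nu) g].
Proof.
split=> [[z [/is_catE[c1 z1] /is_catE[c2 z2] dg]]|[c1 c2 [dg tg]]].
  by split=> //; split=> // i; have := congr1 (fun u : infpath E => u i) z1;
    rewrite z2.
exists (inf_shift (grange g) (flength mu)); split=> //; apply/is_catE; split=> //.
exact: infpath_ext.
Qed.

Lemma bisection_range_inj mu nu g h : bisection mu nu g -> bisection mu nu h ->
  grange g = grange h -> g = h.
Proof.
move=> [z [/is_catE[_ zg] [_ sg] dg]] [w [/is_catE[_ wh] [_ sh] dh]] gh.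
apply: ggP => //; first by rewrite dg dh.
apply: infpath_ext => i; rewrite sg sh.
by rewrite zg wh gh.
Qed.

Lemma bisection_inv mu nu g : bisection mu nu (ginv g) <-> bisection nu mu g.
Proof.
by split=> -[z [? ? dg]]; exists z; split=> //; rewrite ?gdegreeV ?dg ?opprB //;
  rewrite -[LHS]opprK -gdegreeV dg opprB.
Qed.

Lemma bisection_source_inj mu nu g h : bisection mu nu g -> bisection mu nu h ->
  gsource g = gsource h -> g = h.
Proof.
move=> Bg Bh gh; rewrite -[g]ginvK -[h]ginvK; congr ginv.
by apply: (@bisection_range_inj nu mu) => //; apply/bisection_inv.
Qed.

Lemma bisection_source mu nu g : bisection mu nu g -> fsource mu = fsource nu.
Proof. by move=> [z [[-> _] [-> _] _]]. Qed.

Lemma bisection_diagP mu g : bisection mu mu g <->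
  cylinder mu (gsource g) /\ g = gunit (gsource g).
Proof.
split=> [/bisectionP[c1 c2 [dg tg]]|[c1 ->]]; last first.
  by apply/bisectionP; split=> //; split=> //; rewrite gdegree1 subrr.
split=> //; apply: ggP => //; last by rewrite dg subrr.
apply: infpath_ext => i; case: (ltnP i (flength mu)) => im; last first.
  by rewrite -(subnKC im) tg.
have [_ e1] := cylinder_edges c1; have [_ e2] := cylinder_edges c2.
by rewrite grange1 e1 // e2 //; apply: set_nth_default.
Qed.

Lemma bisection_unit mu nu x : bisection mu nu (gunit x) -> mu = nu.
Proof.
move=> /bisectionP[c1 c2 [+ _]]; rewrite gdegree1 => /esym/eqP.
rewrite subr_eq0 => /eqP[mn].
apply: fpath_eq; first by rewrite (cylinder_edges c1).1 (cylinder_edges c2).1.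
by rewrite -(cylinder_prefix c1) -(cylinder_prefix c2) mn.
Qed.

Lemma bisection_ex g : exists mu nu, bisection mu nu g /\ fsource mu = fsource nu.
Proof.
have [a [b [dg tg]]] := tail_ex g.
have Bg : bisection (inf_prefix (grange g) a) (inf_prefix (gsource g) b) g.
  by apply/bisectionP; rewrite !flength_prefix; split=> //;
    exact: cylinder_prefix_self.
exists (inf_prefix (grange g) a), (inf_prefix (gsource g) b).
by split=> //; exact: bisection_source Bg.
Qed.

(** Basic bisections are closed as well as open: whether [Z(mu, nu)] contains an
    element is decided by finitely many edges of its range and its source, since
    from then on the two paths have the same tail. *)
Lemma bisection_locally mu nu a b N g h : (flength mu < N)%N ->
  (flength nu < N)%N -> tail a b g -> tail a b h ->
  agree a (grange g) (grange h) -> agree (b + N) (gsource g) (gsource h) ->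
  bisection mu nu g -> bisection mu nu h.
Proof.
move=> muN nuN [dg tg] [dh th] rgh sgh /bisectionP[c1 c2 [dm tm]].
have rgh' : agree (a + N) (grange g) (grange h).
  move=> i iN; case: (ltnP i a) => [/rgh //|ai].
  by rewrite -(subnKC ai) tg th sgh //; lia.
apply/bisectionP; split.
- by apply: (cylinder_agree _ _ c1 rgh'); lia.
- by apply: (cylinder_agree _ _ c2 sgh); lia.
split; first by rewrite dh -dg.
move=> i; case: (ltnP (flength mu + i) a) => [ia|ai].
  by rewrite -rgh // tm sgh //; lia.
have -> : (flength nu + i = b + (flength mu + i - a))%N by lia.
by rewrite -th subnKC.
Qed.

(** The source of [g] can be moved within a neighbourhood, the range following by
    replacing its tail; agreement up to the edge [b] itself ensures that the new
    tail attaches to the old prefix. *)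
Lemma splice_ex a b g w : tail a b g -> agree b.+1 (gsource g) w ->
  exists h, [/\ tail a b h, agree a (grange g) (grange h) & gsource h = w].
Proof.
move=> [dg tg] gw.
pose u i := if (i < a)%N then grange g i else w (b + (i - a))%N.
have uP i : esource (u i) = erange (u i.+1).
  rewrite /u; case: (ltnP i.+1 a) => [ia|ai].
    by rewrite (ltn_trans (ltnSn _) ia) infpathP.
  case: (ltnP i a) => [ia|ai']; last by rewrite subSn // addnS infpathP.
  have -> : i.+1 = a by lia.
  rewrite subnn addn0 -gw // -[b in RHS]addn0 -tg addn0 infpathP.
  by congr (erange (grange g _)); lia.
have hP : graph_groupoid_set (InfPath uP, gdegree g, w).
  apply/graph_groupoid_setP; exists a, b; split=> // n.
  by rewrite /= /u ltnNge leq_addr /= addKn.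
pose h : G := exist _ (InfPath uP, gdegree g, w) (mem_set hP).
exists h; split=> //.
  by split=> // n; rewrite /grange /gsource /= /u ltnNge leq_addr /= addKn.
by move=> i ia; rewrite /grange /= /u ia.
Qed.

(** Comparing the two descriptions of the tail of [u] shows that, beyond a fixed
    index, every [w] near [x] is periodic with period the difference [p] of the two
    lags. Such a [w] is determined by an initial segment that it shares with [x]. *)
Lemma lag_isolated a b a' b' x N : (a%:Z - b%:Z != a'%:Z - b'%:Z) ->
  (forall w, agree N x w -> exists u : infpath E,
    (forall i, u (a + i)%N = w (b + i)%N) /\
    (forall i, u (a' + i)%N = w (b' + i)%N)) ->
  isolated_path x.
Proof.
wlog lt : a b a' b' / (a%:Z - b%:Z < a'%:Z - b'%:Z).
  move=> H ne; move: (ne); rewrite neq_lt => /orP[/H|/H] ; first exact.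
  move=> /(_ _) H' P; apply: H' => [|w /P[u [u1 u2]]]; first by rewrite eq_sym.
  by exists u.
move=> _ P.
pose S := (b + a' + N + b')%N; pose p := (a' + b - (a + b'))%N.
have per w i : agree N x w -> (S <= i)%N -> w i = w (i - p)%N.
  move=> /P[u [u1 u2]] Si.
  have e1 := u1 (i - b)%N; have e2 := u2 (i - b + a - a')%N.
  have : (a + (i - b) = a' + (i - b + a - a'))%N by rewrite /S in Si; lia.
  move=> e; rewrite e e2 in e1.
  have -> : i = (b + (i - b))%N by rewrite /S in Si; lia.
  rewrite -e1; congr (w _); rewrite /S in Si; rewrite /p; lia.
apply: (@agree_isolated _ _ S) => y xy.
have xyN : agree N x y by move=> i iN; apply: xy; rewrite /S; lia.
apply: infpath_ext => i; elim/ltn_ind: i => i IH.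
case: (ltnP i S) => [/xy //|Si].
rewrite (per _ _ xyN Si) (per x _ _ Si) // IH //.
by rewrite /S in Si; rewrite /p; lia.
Qed.

End Groupoid.

(** * Products of basic bisections *)

Section Products.
Variable E : digraph.
Local Notation G := (graph_groupoid E).
Implicit Types (g h c : G) (x y z w : infpath E) (mu nu rho tau : Defs.fpath E).
Implicit Types B C : set G.

Lemma cat_ex mu z : fsource mu = infrange z -> exists x, is_cat mu z x.
Proof.
case: mu => v p; elim: p v => [|e p IH] v vp sz.
  by exists z; split=> // i; rewrite subn0.
have /andP[/eqP ev pe] := vp.
have [x [sx xE]] := IH (esource e) pe sz.
have ex : infrange x = esource e.
  by have [<- _] := cylinder_edges (ex_intro _ z (conj sx xE) : cylinder (FPath pe) x).
pose u i := if i is j.+1 then x j else e.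
have uP i : esource (u i) = erange (u i.+1).
  by case: i => [|i] /=; [rewrite -ex|exact: infpathP].
exists (InfPath uP); split=> // -[|i] //=; rewrite xE /flength /= ltnS subSS.
Qed.

Lemma bisection_source_ex mu nu w : fsource mu = fsource nu -> cylinder nu w ->
  exists h, bisection mu nu h /\ gsource h = w.
Proof.
move=> mn [z zw]; have [x zx] : exists x, is_cat mu z x.
  by apply: cat_ex; rewrite mn; case: zw.
have hP : graph_groupoid_set (x, (flength mu)%:Z - (flength nu)%:Z, w).
  by exists mu, nu, z.
pose h : G := exist _ (x, (flength mu)%:Z - (flength nu)%:Z, w) (mem_set hP).
by exists h; split=> //; exists z.
Qed.

Definition set_gmul B C : set G :=
  [set c | exists h k, [/\ B h, C k, gsource h = grange k & c = gmul h k]].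

Definition basic_bisection B :=
  exists mu nu, fsource mu = fsource nu /\ B = bisection mu nu.

(** When [rho] extends [nu], say [rho = nu rho'], the product is [Z(mu rho', tau)].
    The path [mu rho'] is written as the prefix of length [m] of the range of an
    element of [Z(mu, nu)] that can be composed with [Z(rho, tau)]. *)
Lemma basic_gmul_le mu nu rho tau : (flength nu <= flength rho)%N ->
  fsource rho = fsource tau ->
  set_gmul (bisection mu nu) (bisection rho tau) = set0 \/
  basic_bisection (set_gmul (bisection mu nu) (bisection rho tau)).
Proof.
move=> nr srt.
have [[c0 [h0 [k0 [Bh0 Ck0 hk0 _]]]]|] :=
  pselect (exists c, set_gmul (bisection mu nu) (bisection rho tau) c); last first.
  by move=> /forallNP n0; left; apply/seteqP; split=> // c /n0.
right; pose m := (flength mu + (flength rho - flength nu))%N.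
pose mu' := inf_prefix (grange h0) m.
have [h0mu h0nu [dh0 th0]] := (bisectionP _ _ _).1 Bh0.
have [k0rho k0tau [dk0 tk0]] := (bisectionP _ _ _).1 Ck0.
have sub_mu : cylinder mu' `<=` cylinder mu.
  by apply: cylinder_ge h0mu _; rewrite leq_addr.
have sub_nu : cylinder rho `<=` cylinder nu.
  by rewrite (cylinder_eq_prefix k0rho) -hk0; exact: cylinder_ge h0nu _.
have m_tail x y i : (forall i, x (flength mu + i)%N = y (flength nu + i)%N) ->
    x (m + i)%N = y (flength rho + i)%N :> edge E.
  by move=> xy; rewrite /m -addnA xy; congr (y _); lia.
exists mu', tau; split.
  rewrite -srt fsource_prefix -[m]addn0 (m_tail _ _ _ th0) hk0.
  by rewrite {2}(cylinder_eq_prefix k0rho) fsource_prefix addn0.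
apply/seteqP; split=> [c [h [k [Bh Ck hk ->]]]|c /bisectionP[cmu ctau [dc tc]]].
  have [hmu hnu [dh th]] := (bisectionP _ _ _).1 Bh.
  have [krho ktau [dk tk]] := (bisectionP _ _ _).1 Ck.
  apply/bisectionP; rewrite /tail grangeM // gsourceM // gdegreeM //.
  split=> //; last first.
    split; first by rewrite flength_prefix dh dk /m; lia.
    by move=> i; rewrite flength_prefix (m_tail _ _ _ th) hk tk.
  apply: (cylinder_transfer (cylinder_prefix_self _ _)).
    by rewrite -(cylinder_edges h0mu).1 -(cylinder_edges hmu).1.
  rewrite flength_prefix => i im; case: (ltnP i (flength mu)) => imu.
    exact: (cylinder2_agree h0mu hmu).
  rewrite -(subnKC imu) th th0 hk hk0; apply: (cylinder2_agree k0rho krho).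
  by rewrite /m in im; lia.
have [k [Ck skc]] := bisection_source_ex srt ctau.
have [krho ktau [dk tk]] := (bisectionP _ _ _).1 Ck.
have kc : gsource c = grange (ginv k) by rewrite grangeV.
exists (gmul c (ginv k)), k; split=> //; rewrite ?gsourceM //; last first.
  by rewrite gmulA // gmulVg skc gmulg1.
rewrite flength_prefix in dc tc.
apply/bisectionP; rewrite /tail grangeM // gsourceM // gdegreeM // gsourceV gdegreeV.
split; [exact: sub_mu|exact: sub_nu|split; first by rewrite dc dk /m; lia].
move=> i; case: (ltnP (flength nu + i) (flength rho)) => ir.
  rewrite -(cylinder_prefixP cmu) ?th0 ?hk0 /m; last lia.
  exact: (cylinder2_agree k0rho krho).
have -> : (flength nu + i = flength rho + (flength nu + i - flength rho))%N by lia.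
rewrite tk skc -tc; congr (grange c _); rewrite /m; lia.
Qed.

Lemma basic_gmul mu nu rho tau : fsource mu = fsource nu ->
  fsource rho = fsource tau ->
  set_gmul (bisection mu nu) (bisection rho tau) = set0 \/
  basic_bisection (set_gmul (bisection mu nu) (bisection rho tau)).
Proof.
move=> smn srt; have [|rn] := leqP (flength nu) (flength rho).
  by move=> nr; exact: basic_gmul_le.
(* Inversion exchanges the two factors and the roles of [nu] and [rho]. *)
have inv_gmul c : set_gmul (bisection mu nu) (bisection rho tau) c <->
    set_gmul (bisection tau rho) (bisection nu mu) (ginv c).
  split=> -[h [k [Bh Ck hk ce]]]; exists (ginv k), (ginv h); split;
    rewrite ?gsourceV ?grangeV //; try exact/bisection_inv.
    rewrite ce; apply: ggP; rewrite ?gdegreeV ?(gdegreeM, gsourceM, grangeM) //=.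
    - by rewrite grangeV gsourceM.
    - by rewrite !gdegreeV opprD addrC.
    - by rewrite gsourceV grangeM.
  apply: (can_inj (@ginvK E)); rewrite ce; apply: ggP.
  - by rewrite grangeV gsourceM ?grangeM.
  - by rewrite gdegreeV !gdegreeM // !gdegreeV opprD !opprK addrC.
  - by rewrite gsourceV grangeM ?gsourceM.
have [e0|[mu' [nu' [s' e']]]] := basic_gmul_le tau (ltnW rn) (esym smn).
  by left; apply/seteqP; split=> // c /inv_gmul; rewrite e0.
right; exists nu', mu'; split=> //; apply/seteqP.
by split=> c; rewrite inv_gmul e' bisection_inv.
Qed.

End Products.

(** * Convolution in the Leavitt path algebra *)

Section Convolution.
Variables (E : digraph) (R : idomainType).
Local Notation G := (graph_groupoid E).
Implicit Types (f g n m d : G -> R) (h c : G) (x : infpath E).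

Lemma sconv_single f g c h0 : grange h0 = grange c ->
  (forall h, grange h = grange c -> f h * g (gmul (ginv h) c) != 0 -> h = h0) ->
  sconv f g c = f h0 * g (gmul (ginv h0) c).
Proof.
move=> hc H; rewrite /sconv -(@fsbig_widen _ _ 0 _ [set h0]) ?fsbig_set1 //.
  by move=> h ->.
move=> h [/= rh nh]; apply/eqP/negP => /negP/(H _ rh); exact: nh.
Qed.

Lemma sconv_neq0 f g c : sconv f g c != 0 ->
  exists h, [/\ grange h = grange c, f h != 0 & g (gmul (ginv h) c) != 0].
Proof.
move=> fg0; have [h rh] := fsbigN1 (x := c)
  (f := fun c h => f h * g (gmul (ginv h) c)) fg0.
by rewrite mulf_eq0 negb_or => /andP[? ?]; exists h.
Qed.

(** The sum defining the convolution is 0 by convention when infinitely many terms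
    are nonzero, so that bilinearity is only available for functions with finite
    fibres. *)
Definition finite_fibres f :=
  forall x, finite_set [set h | grange h = x /\ f h != 0].

Lemma sconvE (A : set G) f g c : (forall h, A h -> grange h = grange c) ->
  (forall h, grange h = grange c -> f h != 0 -> A h) ->
  sconv f g c = \sum_(h \in A) f h * g (gmul (ginv h) c).
Proof.
move=> Ac cA; rewrite /sconv; apply/esym/fsbig_widen => // h [/= rh nA].
by apply/eqP; rewrite mulf_eq0; apply/orP; left; apply/negP => /negP/(cA _ rh).
Qed.

Lemma sconv_consl a f1 f2 g c : finite_fibres f1 -> finite_fibres f2 ->
  sconv (fun h => a * f1 h + f2 h) g c = a * sconv f1 g c + sconv f2 g c.
Proof.
move=> F1 F2; pose A := [set h | grange h = grange c /\ f1 h != 0] `|`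
  [set h | grange h = grange c /\ f2 h != 0].
rewrite (sconvE (A := A)) => [||h rh]; first last.
- have [f10|] := eqVneq (f1 h) 0; last by left.
  by rewrite f10 mulr0 add0r; right.
- by move=> h [] [].
rewrite (sconvE (A := A) (f := f1)) => [||h rh]; first last.
- by left.
- by move=> h [] [].
rewrite (sconvE (A := A) (f := f2)) => [||h rh]; first last.
- by right.
- by move=> h [] [].
rewrite mulr_fsumr -fsbig_split /=; last by rewrite finite_setU.
by apply: eq_fsbigr => h _; rewrite mulrDl mulrA.
Qed.

Lemma sconv_consr a f g1 g2 c : finite_fibres f ->
  sconv f (fun h => a * g1 h + g2 h) c = a * sconv f g1 c + sconv f g2 c.
Proof.
move=> F; pose A := [set h | grange h = grange c /\ f h != 0].
have sE g : sconv f g c = \sum_(h \in A) f h * g (gmul (ginv h) c).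
  by apply: sconvE => h; [case|].
rewrite !sE mulr_fsumr -fsbig_split; last exact: F.
by apply: eq_fsbigr => h _; rewrite mulrDr mulrCA.
Qed.

Lemma bisection_finite_fibres mu nu : finite_fibres \1_(bisection (E := E) mu nu).
Proof.
move=> x; have [[h0 [rh0 Bh0]]|] :=
  pselect (exists h, grange h = x /\ bisection mu nu h); last first.
  move=> /forallNP nh; rewrite (_ : [set _ | _] = set0) //.
  by apply/seteqP; split=> // h [rh /indic_neq0 Bh]; case: (nh h).
apply: (@sub_finite_set _ _ [set h0]); last exact: finite_set1.
move=> h [rh /indic_neq0 Bh]; apply: (bisection_range_inj Bh Bh0).
by rewrite rh rh0.
Qed.

Lemma leavitt_finite_fibres f : leavitt f -> finite_fibres f.
Proof.
move=> Lf; elim/indic_span_ind: f / Lf => [|a B f [mu [nu [_ ->]]] _ Ff] x.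
  rewrite (_ : [set _ | _] = set0) //; apply/seteqP; split=> // h [_].
  by rewrite eqxx.
have := bisection_finite_fibres mu nu x => FB.
apply: (@sub_finite_set _ _ ([set h | grange h = x /\
    \1_(bisection mu nu) h != 0 :> R] `|` [set h | grange h = x /\ f h != 0])).
  move=> h [rh]; have [->|? _] := eqVneq (\1_(bisection mu nu) h : R) 0.
    by rewrite mulr0 add0r => fh; right.
  by left.
by rewrite finite_setU.
Qed.

Lemma sconv_indic mu nu rho tau :
  sconv \1_(bisection (E := E) mu nu) \1_(bisection rho tau) =
  \1_(set_gmul (bisection mu nu) (bisection rho tau)) :> (G -> R).
Proof.
apply/funext => c.
have [[h [k [Bh Ck hk ce]]]|nc] :=
  pselect (set_gmul (bisection mu nu) (bisection rho tau) c).
  rewrite (sconv_single (h0 := h)); first last.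
  - move=> h' rh'; rewrite mulf_eq0 negb_or => /andP[/indic_neq0 Bh' _].
    by apply: (bisection_range_inj Bh' Bh); rewrite rh' ce grangeM.
  - by rewrite ce grangeM.
  rewrite !indic_eq1 ?mulr1 //; first by exists h, k.
  by rewrite ce gmulKg.
rewrite (indic_eq0 _ nc); apply/eqP/negP => /negP/sconv_neq0.
move=> [h [rh /indic_neq0 Bh /indic_neq0 Ck]]; apply: nc.
exists h, (gmul (ginv h) c); split=> //; first by rewrite grangeM.
by rewrite gmulVKg.
Qed.

Lemma leavitt_sconv f g : leavitt f -> leavitt g -> leavitt (sconv f g).
Proof.
move=> Lf Lg; elim/indic_span_ind: f / Lf => [|a B f [mu [nu [smn ->]]] Lf IH].
  rewrite (_ : sconv _ _ = fun=> 0); first exact: indic_span0.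
  apply/funext => c; apply/eqP/negP => /negP/sconv_neq0[h [_]].
  by rewrite eqxx.
rewrite (_ : sconv _ _ =
  (fun c => a * sconv \1_(bisection mu nu) g c + sconv f g c)); last first.
  apply/funext => c; apply: sconv_consl; first exact: bisection_finite_fibres.
  exact: leavitt_finite_fibres.
apply: indic_spanD => //; apply: indic_spanZ.
elim/indic_span_ind: g / Lg {f Lf IH} => [|b C g [rho [tau [srt ->]]] Lg IH].
  rewrite (_ : sconv _ _ = fun=> 0); first exact: indic_span0.
  apply/funext => c; apply/eqP/negP => /negP/sconv_neq0[h [_ _]].
  by rewrite eqxx.
rewrite (_ : sconv _ _ = (fun c => b * sconv \1_(bisection mu nu)
  \1_(bisection rho tau) c + sconv \1_(bisection mu nu) g c)); last first.
  by apply/funext => c; apply: sconv_consr; exact: bisection_finite_fibres.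
apply: indic_spanD => //; apply: indic_spanZ; rewrite sconv_indic.
have [->|] := basic_gmul smn srt; last exact: indic_span_indic.
rewrite (_ : \1_set0 = fun=> 0); first exact: indic_span0.
by apply/funext => c; rewrite indic_eq0.
Qed.

(** Elements of [L] are locally constant; neighbourhoods of [c] are described by
    moving the source of [c] as in [splice_ex]. *)
Lemma leavitt_locally f c a b : leavitt f -> tail a b c ->
  exists N, forall h, tail a b h -> agree a (grange c) (grange h) ->
    agree (b + N) (gsource c) (gsource h) -> f h = f c.
Proof.
move=> Lf tc; elim/indic_span_ind: f / Lf => [|r B f [mu [nu [_ ->]]] _ [N IH]].
  by exists 0%N.
pose M := (N + (flength mu + flength nu).+1)%N; exists M => h th rch sch.
rewrite (IH h th rch) => [|i iN]; last by apply: sch; rewrite /M; lia.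
congr (_ * _ + _).
have key u v : tail a b u -> tail a b v -> agree a (grange u) (grange v) ->
    agree (b + M) (gsource u) (gsource v) ->
    bisection mu nu u -> bisection mu nu v.
  by apply: bisection_locally; rewrite /M; lia.
have [Bc|nBc] := pselect (bisection mu nu c).
  by rewrite !indic_eq1 //; exact: key th rch sch Bc.
rewrite !indic_eq0 // => Bh; apply/nBc/(key h) => // i ilt; apply/esym.
- exact: rch.
- exact: sch.
Qed.

(** Only finitely many elements of the support have range [y]; a long enough prefix
    of [x] separates [x] from all their sources other than [x]. *)
Lemma leavitt_isolate f x y : leavitt f -> exists N, forall h, f h != 0 ->
  grange h = y -> agree N x (gsource h) -> gsource h = x.
Proof.
move=> Lf; elim/indic_span_ind: f / Lf => [|a B f [mu [nu [_ ->]]] _ [N IH]].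
  by exists 0%N => h; rewrite eqxx.
have [M BM] : exists M, forall h, bisection mu nu h ->
    grange h = y -> agree M x (gsource h) -> gsource h = x.
  have [[h0 [Bh0 rh0 sh0]]|nh] := pselect (exists h, [/\ bisection mu nu h,
      grange h = y & gsource h <> x]); last first.
    exists 0%N => h Bh rh _; apply: contrapT => sh; apply: nh.
    by exists h.
  have [i si] : exists i, x i <> gsource h0 i.
    apply: contrapT => /forallNP H; apply: sh0; apply: infpath_ext => i.
    by have /contrapT := H i.
  exists i.+1 => h Bh rh /(_ i (ltnSn i)) xi; case: si; rewrite xi.
  by congr (gsource _ i); apply: (bisection_range_inj Bh Bh0); rewrite rh rh0.
exists (maxn M N) => h fh rh xh.
have [B0|nB0] := eqVneq (\1_(bisection mu nu) h : R) 0.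
  apply: IH => //; first by move: fh; rewrite B0 mulr0 add0r.
  by move=> i iN; apply: xh; rewrite leq_max iN orbT.
apply: BM => //; first exact/(@indic_neq0 R).
by move=> i iN; apply: xh; rewrite leq_max iN.
Qed.

Lemma leavitt_degree f : leavitt f ->
  exists M : nat, forall h, f h != 0 -> (`|gdegree h| <= M)%N.
Proof.
move=> Lf; elim/indic_span_ind: f / Lf => [|a B f [mu [nu [_ ->]]] _ [N IH]].
  by exists 0%N => h; rewrite eqxx.
exists (N + flength mu + flength nu)%N => h.
have [B0|/indic_neq0/bisectionP[_ _ [dh _]]] :=
  eqVneq (\1_(bisection mu nu) h : R) 0; last by rewrite dh; lia.
by rewrite B0 mulr0 add0r => /IH; lia.
Qed.

Definition unit_supported f := forall h, f h != 0 -> h = gunit (gsource h).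

(** Restriction to the unit space maps [L] to [D]: a basic bisection that meets
    the unit space is contained in it. *)
Lemma leavitt_diagonal f :
  leavitt f -> unit_supported f -> lpa_diagonal f.
Proof.
move=> Lf fU; pose U := [set h : G | h = gunit (gsource h)].
have -> : f = (fun h => \1_U h * f h).
  apply/funext => h; have [->|/fU hU] := eqVneq (f h) 0; first by rewrite mulr0.
  by rewrite indic_eq1 ?mul1r.
elim/indic_span_ind: f / Lf {fU} => [|a B f [mu [nu [_ ->]]] _ IH].
  rewrite (_ : (fun _ => _) = fun=> 0); first exact: indic_span0.
  by apply/funext => h; rewrite mulr0.
have [[x Bx]|nB] := pselect (exists x, bisection mu nu (gunit x)); last first.
  rewrite (_ : (fun _ => _) = fun h => \1_U h * f h) //.
  apply/funext => h; have [Uh|nUh] := pselect (U h); last first.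
    by rewrite indic_eq0 // !mul0r.
  rewrite [X in a * X]indic_eq0 ?mulr0 ?add0r // => Bh.
  by apply: nB; exists (gsource h); rewrite -Uh.
have e := bisection_unit Bx; subst nu.
rewrite (_ : (fun _ => _) =
  (fun h => a * \1_(bisection mu mu) h + \1_U h * f h)); last first.
  apply/funext => h; rewrite mulrDr; congr (_ + _).
  have [Bh|nBh] := pselect (bisection mu mu h); last first.
    by rewrite [X in a * X]indic_eq0 // !mulr0.
  by rewrite [\1_U h]indic_eq1 ?mul1r //; have [] := (bisection_diagP _ _).1 Bh.
by apply: indic_span_cons => //; exists mu.
Qed.

Lemma diagonal_leavitt d : lpa_diagonal d -> leavitt d.
Proof.
move=> Dd; elim/indic_span_ind: d / Dd => [|a B f [mu ->] _]; first exact: indic_span0.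
by apply: indic_span_cons; exists mu, mu.
Qed.

Lemma diagonal_unit d : lpa_diagonal d -> unit_supported d.
Proof.
move=> Dd h; elim/indic_span_ind: d / Dd => [|a B f [mu ->] _ IH].
  by rewrite eqxx.
have [B0|/indic_neq0/bisection_diagP[] //] :=
  eqVneq (\1_(bisection mu mu) h : R) 0.
by rewrite B0 mulr0 add0r => /IH.
Qed.

End Convolution.

(** * Normalizers of the diagonal *)

Lemma ex_maximal (T : Type) (P : T -> Prop) (e : T -> int) (M : nat) :
  (forall t, P t -> e t <= M%:Z) -> (exists t, P t) ->
  exists t, P t /\ forall u, P u -> e u <= e t.
Proof.
move=> PM [t Pt]; pose Q k := `[< exists u, P u /\ M%:Z - e u = k%:Z >].
have Qof u : P u -> Q (absz (M%:Z - e u)).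
  by move=> Pu; apply/asboolP; exists u; split=> //; have := PM _ Pu; lia.
have [k /asboolP[u [Pu uk]] kmin] := ex_minnP (ex_intro Q _ (Qof _ Pt)).
exists u; split=> // v Pv; have := kmin _ (Qof _ Pv); have := PM _ Pv; lia.
Qed.

Section Normalizer.
Variables (E : digraph) (R : idomainType) (bar : {rmorphism R -> R}).
Hypothesis barK : involutive bar.
Local Notation G := (graph_groupoid E).
Local Notation star := (sstar bar).
Implicit Types (f n m d : G -> R) (g h k c : G) (x : infpath E).

Lemma bar_neq0 r : (bar r != 0) = (r != 0).
Proof.
congr (~~ _); apply/eqP/eqP => [r0|->]; last exact: rmorph0.
by rewrite -[r]barK r0 rmorph0.
Qed.

Lemma sstar_neq0 f g : ((star f) g != 0) = (f (ginv g) != 0).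
Proof. exact: bar_neq0. Qed.

Lemma sstarK f : star (star f) = f.
Proof. by apply/funext => g; rewrite /sstar ginvK barK. Qed.

Lemma leavitt_sstar f : leavitt f -> leavitt (star f).
Proof.
move=> Lf; elim/indic_span_ind: f / Lf => [|a B f [mu [nu [smn ->]]] _ IH].
  rewrite (_ : star _ = fun=> 0); first exact: indic_span0.
  by apply/funext => g; rewrite /sstar rmorph0.
rewrite (_ : star _ = fun g => bar a * \1_(bisection nu mu) g + (star f) g).
  by apply: indic_span_cons => //; exists nu, mu.
apply/funext => g; rewrite /sstar rmorphD rmorphM; congr (_ * _ + _).
have [Bg|nBg] := pselect (bisection nu mu g).
  by rewrite !indic_eq1 ?rmorph1 //; exact/bisection_inv.
by rewrite !indic_eq0 ?rmorph0 // => /bisection_inv.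
Qed.

Lemma gmulV_unit h c : grange h = grange c ->
  gmul (ginv h) c = gunit (gsource (gmul (ginv h) c)) -> h = c.
Proof.
move=> rh u.
have hc : gsource (ginv h) = grange c by [].
have := congr1 (@gdegree E) u; rewrite gdegreeM // gdegree1 gdegreeV => d0.
have := congr1 (@grange E) u; rewrite grangeM // grange1 gsourceM // => s0.
by apply: ggP => //; apply/eqP; rewrite -subr_eq0 -oppr_eq0 opprB addrC d0.
Qed.

Lemma sconv_unitr f d c : unit_supported d ->
  sconv f d c = f c * d (gunit (gsource c)).
Proof.
move=> dU; rewrite (@sconv_single _ _ _ _ _ c) ?gmulVg // => h rh.
by rewrite mulf_eq0 negb_or => /andP[_ /dU /gmulV_unit ->].
Qed.

Lemma sconv_unitl d f c : unit_supported d ->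
  sconv d f c = d (gunit (grange c)) * f c.
Proof.
move=> dU; rewrite (@sconv_single _ _ _ _ _ (gunit (grange c))) //.
  congr (_ * f _); rewrite -[RHS]gmul1g; congr gmul.
  by apply: ggP => //; rewrite gdegreeV gdegree1 oppr0.
move=> h rh; rewrite mulf_eq0 negb_or => /andP[/dU hU _].
by rewrite hU; congr gunit; rewrite -rh hU.
Qed.

(** Functions whose support is a bisection of [G]. *)
Definition bisective n :=
  (forall g h, n g != 0 -> n h != 0 -> gsource g = gsource h -> g = h) /\
  (forall g h, n g != 0 -> n h != 0 -> grange g = grange h -> g = h).

(** For [g] and [h] in the support with a common source [x], let [c1] have maximal
    degree among the elements with the range of [g], and [c2] minimal degree among
    those with the range of [h]. In the value of [n d n^*] at [c1 c2^-1], with [d]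
    the indicator of a small cylinder around [x], the term of [c1] is the only
    nonzero one, so that [c1 c2^-1] is a unit. Hence
    [deg g <= deg c1 = deg c2 <= deg h]. *)
Lemma normalizer_extremal n g h : leavitt n ->
  (forall d, lpa_diagonal d -> lpa_diagonal (sconv (sconv n d) (star n))) ->
  n g != 0 -> n h != 0 -> gsource g = gsource h ->
  grange g = grange h /\ gdegree g <= gdegree h.
Proof.
move=> Ln nD ng nh gh; set x := gsource g in gh.
have [M nM] := leavitt_degree Ln.
have [N nN] := leavitt_isolate x (grange g) Ln.
have [c1 [[n1 s1 r1] max1]] := @ex_maximal G
  (fun c => [/\ n c != 0, gsource c = x & grange c = grange g])
  (@gdegree E) M ltac:(by move=> c [/nM]; lia) (ex_intro _ g (And3 ng erefl erefl)).
have [c2 [[n2 s2 r2] min2]] := @ex_maximal G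
  (fun c => [/\ n c != 0, gsource c = x & grange c = grange h])
  (fun c => - gdegree c) M ltac:(by move=> c [/nM]; lia)
  (ex_intro _ h (And3 nh (esym gh) erefl)).
pose mu := inf_prefix x N; pose d : G -> R := \1_(bisection mu mu).
have Dd : lpa_diagonal d by apply: indic_span_indic; exists mu.
have dU : unit_supported d by exact: diagonal_unit.
have c12 : gsource c1 = grange (ginv c2) by rewrite s1 -s2.
pose c := gmul c1 (ginv c2).
have rc : grange c = grange c1 by rewrite grangeM.
have sc : gsource c = grange c2 by rewrite gsourceM.
have dc : gdegree c = gdegree c1 - gdegree c2 by rewrite gdegreeM.
have Fc : sconv (sconv n d) (star n) c != 0.
  rewrite (@sconv_single _ _ _ _ _ c1); first 1 last.
  - by rewrite rc.
  - move=> k rk; rewrite sconv_unitr // mulf_eq0 negb_or mulf_eq0 negb_or.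
    case/andP => /andP[nk /indic_neq0/bisection_diagP[/cylinder_prefixP xk _]].
    (* The cylinder was chosen so that only elements with source [x] contribute. *)
    have sk : gsource k = x by apply: nN => //; rewrite rk rc.
    rewrite sstar_neq0 => nkc.
    have kc : gsource (ginv k) = grange c by rewrite gsourceV.
    have e1 : gsource (ginv (gmul (ginv k) c)) = x.
      by rewrite gsourceV grangeM // grangeV.
    have e2 : grange (ginv (gmul (ginv k) c)) = grange h.
      by rewrite grangeV gsourceM // sc.
    have := min2 _ (And3 nkc e1 e2).
    rewrite gdegreeV gdegreeM // gdegreeV dc => le1.
    have := max1 k (And3 nk sk (etrans rk (etrans rc r1))) => le2.
    apply: ggP; [by rewrite rk rc|lia|by rewrite sk s1].
  rewrite mulf_neq0 //; last by rewrite sstar_neq0 gmulKg // ginvK.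
  rewrite sconv_unitr // mulf_neq0 //; apply/indic_neq0/bisection_diagP.
  by split=> //; rewrite gsource1 s1; exact: cylinder_prefix_self.
have cU := diagonal_unit (nD _ Dd) Fc.
have e1 : gdegree c = 0 by rewrite cU.
have e2 : grange c = gsource c by rewrite [in LHS]cU.
split; first by rewrite -r1 -r2 -rc -sc.
have := max1 g (And3 ng erefl erefl); have := min2 h (And3 nh (esym gh) erefl).
by move: e1; rewrite dc; lia.
Qed.

(** By symmetry in [g] and [h] the inequality of degrees is an equality. *)
Lemma normalizer_source_inj n : leavitt n ->
  (forall d, lpa_diagonal d -> lpa_diagonal (sconv (sconv n d) (star n))) ->
  forall g h, n g != 0 -> n h != 0 -> gsource g = gsource h -> g = h.
Proof.
move=> Ln nD g h ng nh gh.
have [rgh le1] := normalizer_extremal Ln nD ng nh gh.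
have [_ le2] := normalizer_extremal Ln nD nh ng (esym gh).
by apply: ggP => //; apply: le_anti; rewrite le1 le2.
Qed.

Lemma bisective_sstar n : bisective n -> bisective (star n).
Proof.
move=> [sn rn]; split=> g h; rewrite !sstar_neq0 => ng nh gh;
  apply: (can_inj (@ginvK E)); [exact: rn|exact: sn].
Qed.

(** A term of [n d n^*] at [c] involves two elements of the support of [n] with the
    same source, whose quotient is [c]; they are equal, so [c] is a unit. *)
Lemma bisective_conj n d : leavitt n -> bisective n -> lpa_diagonal d ->
  lpa_diagonal (sconv (sconv n d) (star n)).
Proof.
move=> Ln [sn rn] Dd; apply: leavitt_diagonal.
  apply: leavitt_sconv (leavitt_sstar Ln).
  exact/leavitt_sconv/diagonal_leavitt.
move=> c /sconv_neq0[k [rk]]; rewrite sconv_unitr; last first.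
  exact: diagonal_unit.
rewrite mulf_eq0 negb_or => /andP[nk _]; rewrite sstar_neq0 => nkc.
have kc : gsource (ginv k) = grange c by [].
have e : k = ginv (gmul (ginv k) c).
  by apply: sn => //; rewrite gsourceV grangeM.
rewrite -[LHS](gmulVKg rk) {1}e.
by rewrite gmulVg gsourceM.
Qed.

Lemma normalizerP n : lpa_normalizer bar n <-> leavitt n /\ bisective n.
Proof.
split=> [[Ln nD]|[Ln Bn]]; last first.
  split=> // d Dd; split; first exact: bisective_conj.
  rewrite -[X in sconv _ X](sstarK n).
  by apply: bisective_conj => //; [exact: leavitt_sstar|exact: bisective_sstar].
split=> //; split=> [|g h ng nh gh].
  by apply: normalizer_source_inj => // d /nD[].
apply: (can_inj (@ginvK E)); apply: (@normalizer_source_inj (star n)) => //.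
- exact: leavitt_sstar.
- by move=> d /nD[_]; rewrite sstarK.
- by rewrite sstar_neq0 ginvK.
- by rewrite sstar_neq0 ginvK.
Qed.

Lemma diagonal_normalizer d : lpa_diagonal d -> lpa_normalizer bar d.
Proof.
move=> Dd; apply/normalizerP; split; first exact: diagonal_leavitt.
by split=> g h /(diagonal_unit Dd) -> /(diagonal_unit Dd) ->;
  rewrite ?(gsource1, grange1) => ->.
Qed.

Lemma normalizer_indic mu nu : fsource mu = fsource nu ->
  lpa_normalizer bar \1_(bisection (E := E) mu nu).
Proof.
move=> smn; apply/normalizerP; split.
  by apply: indic_span_indic; exists mu, nu.
split=> g h /indic_neq0 Bg /indic_neq0 Bh.
  exact: bisection_source_inj Bg Bh.
exact: bisection_range_inj Bg Bh.
Qed.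

Lemma normalizer_sstar n : lpa_normalizer bar n -> lpa_normalizer bar (star n).
Proof.
move=> /normalizerP[Ln Bn]; apply/normalizerP.
by split; [exact: leavitt_sstar|exact: bisective_sstar].
Qed.

Lemma normalizer_sconv n m : lpa_normalizer bar n -> lpa_normalizer bar m ->
  lpa_normalizer bar (sconv n m).
Proof.
move=> /normalizerP[Ln [sn rn]] /normalizerP[Lm [sm rm]]; apply/normalizerP.
split; first exact: leavitt_sconv.
split=> g h /sconv_neq0[k [rk nk mk]] /sconv_neq0[l [rl nl ml]] gh.
  have e : gmul (ginv k) g = gmul (ginv l) h by apply: sm => //; rewrite !gsourceM.
  have kl : k = l.
    apply: sn => //; have := congr1 (@grange E) e.
    by rewrite !grangeM.
  by rewrite -[LHS](gmulVKg rk) -[RHS](gmulVKg rl) e kl.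
have kl : k = l by apply: rn => //; rewrite rk gh.
have e : gmul (ginv k) g = gmul (ginv l) h.
  by apply: rm => //; rewrite !grangeM // kl.
by rewrite -[LHS](gmulVKg rk) -[RHS](gmulVKg rl) e kl.
Qed.

(** * The element of [G] picked out by a normalizer at a point *)

Definition branch n x c := n c != 0 /\ gsource c = x.

Lemma branch_unique n x c c' : lpa_normalizer bar n ->
  branch n x c -> branch n x c' -> c = c'.
Proof.
by move=> /normalizerP[_ [sn _]] [nc sc] [nc' sc']; apply: sn => //; rewrite sc.
Qed.

Lemma DomP n x : lpa_normalizer bar n -> Dom bar n x <-> exists c, branch n x c.
Proof.
move=> /normalizerP[Ln [sn rn]]; split=> [/sconv_neq0[h [rh nh _]]|[c [nc sc]]].
  by exists (ginv h); rewrite sstar_neq0 in nh.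
rewrite /Dom /supp /= (@sconv_single _ _ _ _ _ (ginv c)) //; first last.
  move=> h rh; rewrite mulf_eq0 negb_or sstar_neq0 => /andP[nh _].
  by rewrite -[h]ginvK; congr ginv; apply: sn => //; rewrite sc.
rewrite mulf_neq0 //; first by rewrite sstar_neq0 ginvK.
by rewrite ginvK -sc gmulg1.
Qed.

Lemma branch_admissible n x c : lpa_normalizer bar n -> branch n x c ->
  admissible bar n x.
Proof. by move=> Nn nc; split=> //; apply/DomP => //; exists c. Qed.

Lemma alpha_branch n x c : lpa_normalizer bar n -> branch n x c ->
  alpha n x = grange c.
Proof.
move=> Nn nc; apply: xget_unique; first by exists c.
by move=> _ [c' nc' <-]; rewrite (branch_unique Nn nc' nc).
Qed.

Lemma branch_sconv n m x c c' : lpa_normalizer bar n ->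
  branch m x c -> branch n (grange c) c' -> branch (sconv n m) x (gmul c' c).
Proof.
move=> /normalizerP[_ [_ rn]] [mc sc] [nc' sc']; split; last by rewrite gsourceM.
rewrite (@sconv_single _ _ _ _ _ c') ?grangeM //.
  by rewrite gmulKg // mulf_neq0.
move=> h rh; rewrite mulf_eq0 negb_or => /andP[nh _]; exact: rn.
Qed.

Lemma branch_sstar n x c : branch n x c -> branch (star n) (grange c) (ginv c).
Proof. by move=> [nc sc]; split=> //; rewrite sstar_neq0 ginvK. Qed.

Lemma branch_locally n x c a b : leavitt n -> branch n x c -> tail a b c ->
  exists N, forall w, agree (b + N) x w ->
    exists h, [/\ tail a b h, agree a (grange c) (grange h) & branch n w h].
Proof.
move=> Ln [nc sc] tc; have [N nN] := leavitt_locally Ln tc.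
exists N.+1 => w xw; rewrite -sc in xw.
have [|h [th ch sh]] := splice_ex tc (w := w).
  by move=> i ib; apply: xw; lia.
exists h; split=> //; split=> //; rewrite (nN h) // sh => i ib; apply: xw; lia.
Qed.

(** At an isolated point, if [c] and [c'] have the same range, then [p_x n^* m p_x]
    is a nonzero multiple of the indicator of [c^-1 c'], so that the degree
    condition says [deg c = deg c']. At another point,
    equality of the maps near [x] implies that of the degrees by [lag_isolated], and
    conversely [n] and [m] are both nonzero at all the elements near [c = c']. *)
Lemma germ_condP n m x c c' : lpa_normalizer bar n -> lpa_normalizer bar m ->
  branch n x c -> branch m x c' -> germ_cond bar n m x <-> c = c'.
Proof.
move=> Nn Nm nc mc'; have [sc sc'] := (nc.2, mc'.2).
have [[Ln Bn] [Lm Bm]] := ((normalizerP n).1 Nn, (normalizerP m).1 Nm).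
have [a [b tc]] := tail_ex c; have [a' [b' tc']] := tail_ex c'.
have [N nN] := branch_locally Ln nc tc.
have pU : unit_supported (p_ R x).
  by move=> h /indic_neq0 ->; rewrite gsource1.
have p1 g : (p_ R x g != 0) <-> g = gunit x.
  by split=> [/indic_neq0|gx]; last exact/indic_neq0.
split=> [[[_ [ac hom]]|[nx [V [oV Vx VD Va]]]]|cc'].
- have rcc' : grange c = grange c'.
    by rewrite -(alpha_branch Nn nc) ac (alpha_branch Nm mc').
  have cV : gsource (ginv c) = grange c' by [].
  have : supp (sconv (sconv (sconv (p_ R x) (star n)) m) (p_ R x))
      (gmul (ginv c) c').
    rewrite /supp /= sconv_unitr // gsourceM // sc' mulf_neq0 //; last exact/p1.
    rewrite (@sconv_single _ _ _ _ _ (ginv c)); first 1 last.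
    - by rewrite grangeM.
    - move=> h rh; rewrite sconv_unitl // mulf_eq0 negb_or mulf_eq0 negb_or.
      case/andP => /andP[_]; rewrite sstar_neq0 => nh _.
      rewrite -[h]ginvK; congr ginv; apply: Bn.1 => //; first exact: nc.1.
      by rewrite gsourceV rh grangeM.
    rewrite sconv_unitl // !mulf_neq0 //.
    - by apply/p1; rewrite grangeV sc.
    - by rewrite sstar_neq0 ginvK nc.1.
    - by rewrite ginvK gmulVKg // mc'.1.
  move=> /hom /=; rewrite gdegreeM // gdegreeV => /eqP.
  rewrite addrC subr_eq0 => /eqP d; apply: ggP => //; by rewrite ?d ?sc ?sc'.
- have [M mM] := branch_locally Lm mc' tc'.
  have [K VK] := open_agree oV Vx.
  have rcc' : grange c = grange c'.
    by rewrite -(alpha_branch Nn nc) Va // (alpha_branch Nm mc').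
  apply: ggP => //; last by rewrite sc.
  apply/eqP; apply: contrapT => /negP; rewrite tc.1 tc'.1 => dcc'.
  apply: nx; apply: (lag_isolated (N := (b + N + (b' + M) + K)%N) dcc') => w xw.
  have [|h [th _ nh]] := nN w; first by move=> i ?; apply: xw; lia.
  have [|h' [th' _ mh']] := mM w; first by move=> i ?; apply: xw; lia.
  have Vw : V w by apply: VK => i ?; apply: xw; lia.
  have rhh' : grange h = grange h'.
    by rewrite -(alpha_branch Nn nh) Va // (alpha_branch Nm mh').
  exists (grange h); rewrite {2}rhh' -{1}nh.2 -mh'.2.
  by split; [exact: th.2|exact: th'.2].
- subst c'; have [Ix|nIx] := pselect (isolated_path x); [left|right]; split=> //.
    split; first by rewrite (alpha_branch Nn nc) (alpha_branch Nm mc').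
    move=> g; rewrite /supp /= sconv_unitr // mulf_eq0 negb_or => /andP[].
    move=> /sconv_neq0[h [rh]]; rewrite sconv_unitl // mulf_eq0 negb_or.
    move=> /andP[/p1/(congr1 (@gsource E))]; rewrite !gsource1 sstar_neq0.
    move=> rhx nh mh /p1/(congr1 (@gsource E)); rewrite !gsource1 => sg.
    have hV : gsource (ginv h) = grange g by [].
    have hc : ginv h = c by apply: (branch_unique Nn _ nc); split.
    have gc : gmul (ginv h) g = c.
      by apply: (branch_unique Nm _ mc'); split=> //; rewrite gsourceM.
    have := congr1 (@gdegree E) gc; rewrite gdegreeM // hc; lia.
  have [M mM] := branch_locally Lm mc' tc.
  exists (cylinder (inf_prefix x (b + N + M))).
  have near w : cylinder (inf_prefix x (b + N + M)) w ->
      exists h, branch n w h /\ branch m w h.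
    move=> /cylinder_prefixP xw.
    have [|h [th ch nh]] := nN w; first by move=> i ?; apply: xw; lia.
    have [|h' [th' ch' mh']] := mM w; first by move=> i ?; apply: xw; lia.
    exists h; split=> //; suff -> : h = h' by [].
    apply: ggP; [|by rewrite th.1 th'.1|by rewrite nh.2 mh'.2].
    apply: infpath_ext => i; case: (ltnP i a) => [ia|ai].
      by rewrite -ch // -ch'.
    by rewrite -(subnKC ai) th.2 th'.2 nh.2 mh'.2.
  split; first exact: open_cylinder.
  - exact: cylinder_prefix_self.
  - by move=> w /near[h [nh mh]]; split; apply/DomP => //; exists h.
  - move=> w /near[h [nh mh]].
    by rewrite (alpha_branch Nn nh) (alpha_branch Nm mh).
Qed.

End Normalizer.

(** * The germ groupoid *)

Section Germs.
Variables (E : digraph) (R : idomainType) (bar : {rmorphism R -> R}).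
Hypothesis barK : involutive bar.
Local Notation G := (graph_groupoid E).
Local Notation W := (germ_class E bar).
Implicit Types (n m d : G -> R) (c : G) (x : infpath E) (a : W).

Definition pair_branch (p : germ_pair E bar) c :=
  branch (sval p).1 (sval p).2 c.

Lemma pair_branch_ex p : exists c, pair_branch p c.
Proof. by case: p => -[n x] /= [Nn]; rewrite /pair_branch /= DomP. Qed.

(** The relation is equality of elements of [G]. It is therefore an equivalence
    relation, and [germ] classes are equal exactly when their elements are. *)
Lemma germ_relP p q c : pair_branch p c -> germ_rel p q <-> pair_branch q c.
Proof.
case: p q => -[n x] [Nn Dn] [[m y] [Nm Dm]]; rewrite /germ_rel /pair_branch /=.
move=> nc; split=> [[xy]|mc].
  rewrite -xy in Dm *; have [c' mc'] := (DomP barK x Nm).1 Dm.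
  by rewrite (germ_condP barK Nn Nm nc mc') => ->.
have xy : x = y by rewrite -nc.2 mc.2.
by rewrite -xy in mc *; split=> //; apply/(germ_condP barK Nn Nm nc mc).
Qed.

Lemma germ_rel_equiv : Equivalence (@germ_rel E R bar).
Proof.
split=> [p|p q|p q r].
- by have [c pc] := pair_branch_ex p; apply/(germ_relP p pc).
- have [c pc] := pair_branch_ex p; move=> /(germ_relP q pc) qc.
  exact/(germ_relP p qc).
- have [c pc] := pair_branch_ex p; move=> /(germ_relP q pc) qc.
  by move=> /(germ_relP r qc) rc; apply/(germ_relP r pc).
Qed.

Lemma germ_class_branch a : exists c, exists n x (nx : admissible bar n x),
  a = germ nx /\ branch n x c.
Proof.
case: a => C [p Cp]; have [c pc] := pair_branch_ex p.
case: p Cp pc => -[n x] nx Cp pc; exists c, n, x, nx; split=> //.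
by apply: eq_exist.
Qed.

Lemma germ_eqP n x (nx : admissible bar n x) m y (my : admissible bar m y) c c' :
  branch n x c -> branch m y c' -> germ nx = germ my <-> c = c'.
Proof.
move=> nc mc'; set p : germ_pair E bar := exist _ (n, x) nx.
set q : germ_pair E bar := exist _ (m, y) my.
have pc : pair_branch p c by []. have qc' : pair_branch q c' by [].
split=> [e|cc'].
  have /(germ_relP q pc) qc : germ_rel p q.
    have [eC] := e; rewrite -/([set r | germ_rel p r] q) eC.
    exact/(germ_relP _ qc').
  exact: branch_unique my.1 qc qc'.
subst c'; apply: eq_exist; apply/seteqP.
by split=> r /=; [move=> /(germ_relP r pc)/(germ_relP r qc')
                 |move=> /(germ_relP r qc')/(germ_relP r pc)].
Qed.

End Germs.

Theorem proposition4p5 (E : digraph) (Efin : row_finite E) (Ens : no_sources E)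
    (R : idomainType) (bar : {rmorphism R -> R}) (barK : involutive bar) :
  Equivalence (@germ_rel E R bar) /\
  (forall d : graph_groupoid E -> R, lpa_diagonal d -> lpa_normalizer bar d) /\
  exists (r s : germ_class E bar -> germ_class E bar)
         (mul : germ_class E bar -> germ_class E bar ->
                option (germ_class E bar))
         (inv : germ_class E bar -> germ_class E bar),
    is_groupoid (germ_units (E := E) (bar := bar)) r s mul inv /\
    (forall n1 x1 n2 x2 (h1 : admissible bar n1 x1)
            (h2 : admissible bar n2 x2),
      (alpha n2 x2 = x1 ->
        exists h : admissible bar (sconv n1 n2) x2,
          mul (germ h1) (germ h2) = Some (germ h)) /\
      (alpha n2 x2 <> x1 -> mul (germ h1) (germ h2) = None)) /\
    (forall n x (h : admissible bar n x),
      [/\ exists h' : admissible bar (sconv n (sstar bar n)) (alpha n x),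
            r (germ h) = germ h',
          exists h' : admissible bar (sconv (sstar bar n) n) x,
            s (germ h) = germ h' &
          exists h' : admissible bar (sstar bar n) (alpha n x),
            inv (germ h) = germ h']).
Proof.
split; first exact: germ_rel_equiv.
split; first by move=> d; exact: diagonal_normalizer.
(* [phi] identifies the set of classes with [G], and [psi] is its inverse. *)
have [phi phiP] := choice (germ_class_branch barK (R := R) (E := E)).
have phi_germ n x (nx : admissible bar n x) c : branch n x c ->
    phi (germ nx) = c.
  move=> nc; have [m [y [my [e mc]]]] := phiP (germ nx).
  exact/esym/(germ_eqP barK nx my nc mc).
have phi_inj a b : phi a = phi b -> a = b.
  have [n [x [nx [an nc]]]] := phiP a; have [m [y [my [bm mc]]]] := phiP b.
  by move=> ab; rewrite an bm; apply/(germ_eqP barK nx my nc mc).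
(* The basic bisections containing [c] give normalizers with element [c]. *)
have phi_surj c : exists a, phi a = c.
  have [mu [nu [Bc smn]]] := bisection_ex c.
  have Bb : branch (\1_(bisection mu nu) : _ -> R) (gsource c) c.
    by split=> //; exact/indic_neq0.
  exists (germ (branch_admissible barK (normalizer_indic barK smn) Bb)).
  exact: phi_germ.
have [psi psiK] := choice phi_surj.
have psiE a c : phi a = c -> psi c = a by move=> ac; apply: phi_inj; rewrite psiK.
have unitsP u : germ_units u <-> phi u = gunit (gsource (phi u)).
  split=> [[d [x [dx [Dd ->]]]]|e].
    have [c dc] := (DomP barK x dx.1).1 dx.2.
    rewrite (phi_germ _ _ _ _ dc); exact: (diagonal_unit Dd dc.1).
  set x := gsource (phi u) in e.
  have Dd : lpa_diagonal (\1_(bisection (inf_prefix x 0) (inf_prefix x 0)) : _ -> R).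
    by apply: indic_span_indic; exists (inf_prefix x 0).
  have Bb : branch (\1_(bisection (inf_prefix x 0) (inf_prefix x 0)) : _ -> R)
      x (gunit x).
    by split=> //; apply/indic_neq0/bisection_diagP; split=> //;
      exact: cylinder_prefix_self.
  exists \1_(bisection (inf_prefix x 0) (inf_prefix x 0)), x,
    (branch_admissible barK (diagonal_normalizer barK Dd) Bb); split=> //.
  by apply: phi_inj; rewrite (phi_germ _ _ _ _ Bb).
pose mul a b := if pselect (gsource (phi a) = grange (phi b))
  then Some (psi (gmul (phi a) (phi b))) else None.
have mulE a b : gsource (phi a) = grange (phi b) ->
    mul a b = Some (psi (gmul (phi a) (phi b))).
  by rewrite /mul; case: pselect.
have mulS a b c : mul a b = Some c ->
    gsource (phi a) = grange (phi b) /\ phi c = gmul (phi a) (phi b).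
  by rewrite /mul; case: pselect => // ab [<-]; rewrite psiK.
exists (fun a => psi (gunit (grange (phi a)))),
  (fun a => psi (gunit (gsource (phi a)))), mul, (fun a => psi (ginv (phi a))).
split; last split.
- split=> [a|a|u|u|a b|a b c|a b c|a b c ab bc|a|a|a|a].
  + by apply/unitsP; rewrite psiK.
  + by apply/unitsP; rewrite psiK.
  + by move=> /unitsP e; apply: psiE; rewrite {1}e; congr gunit; rewrite e.
  + by move=> /unitsP e; apply: psiE.
  + rewrite /mul; case: pselect => ab; split=> //.
      by move=> _; rewrite ab.
    by move=> /(congr1 phi); rewrite !psiK => /(congr1 (@grange E)).
  + by move=> /mulS[ab ->]; rewrite grangeM.
  + by move=> /mulS[ab ->]; rewrite gsourceM.
  + move=> /mulS[pab ec] /mulS[pbc ebc].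
    rewrite !mulE ?ec ?ebc ?gsourceM ?grangeM //; congr (Some (psi _)).
    exact: gmulA.
  + by rewrite mulE psiK // gmul1g; congr Some; exact: psiE.
  + by rewrite mulE psiK // gmulg1; congr Some; exact: psiE.
  + by rewrite mulE psiK // gmulgV.
  + by rewrite mulE psiK // gmulVg.
- move=> n1 x1 n2 x2 h1 h2.
  have [c1 nc1] := (DomP barK x1 h1.1).1 h1.2.
  have [c2 nc2] := (DomP barK x2 h2.1).1 h2.2.
  have [p1 p2] := (phi_germ _ _ h1 _ nc1, phi_germ _ _ h2 _ nc2).
  rewrite (alpha_branch barK h2.1 nc2); split=> [c21|c21]; last first.
    rewrite /mul p1 p2; case: pselect => // c12; case: c21.
    by rewrite -c12; exact: nc1.2.
  have nc1' : branch n1 (grange c2) c1 by rewrite c21.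
  have nc := branch_sconv barK h1.1 nc2 nc1'.
  exists (branch_admissible barK (normalizer_sconv barK h1.1 h2.1) nc).
  rewrite mulE p1 p2; last exact: nc1'.2.
  by congr Some; apply: psiE; exact: phi_germ.
- move=> n x h; have [c nc] := (DomP barK x h.1).1 h.2.
  have Ns := normalizer_sstar barK h.1; have nV := branch_sstar barK nc.
  rewrite (alpha_branch barK h.1 nc) (phi_germ _ _ h _ nc).
  have ncx : branch n (grange (ginv c)) c by split; [exact: nc.1|].
  have nr := branch_sconv barK h.1 nV ncx; rewrite gmulgV in nr.
  have ns := branch_sconv barK Ns nc nV; rewrite gmulVg in ns.
  split.
  + exists (branch_admissible barK (normalizer_sconv barK h.1 Ns) nr).
    by apply: psiE; exact: phi_germ.
  + exists (branch_admissible barK (normalizer_sconv barK Ns h.1) ns).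
    by apply: psiE; exact: phi_germ.
  + exists (branch_admissible barK Ns nV); by apply: psiE; exact: phi_germ.
Qed.
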